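(* Let $\mu,\nu$ be Borel probability measures on $\mathbb R$ with finite first absolute moments. For the rectangular cost function $$c(x,y,x',y')=|(x-x')(y-y')|,$$ the diamond transport $\pi_{\rm dia}$ is the unique minimizer of $\pi\mapsto\iint c(x,y,x',y')\,\mathrm d\pi(x,y)\,\mathrm d\pi(x',y')$ over $\pi\in\Pi(\mu,\nu)$.
   Context: $\Pi(\mu,\nu)$ is the set of all probability measures on $\mathbb R^2$ with marginals $\mu,\nu$. $Q_\mu(t)=\inf\{x\in\mathbb R:\mu((-\infty,x])\ge t\}$ is the left quantile function. Let $D=\{(x,y)\in[0,1]^2:|y-1/2|+|x-1/2|=1/2\}$. The diamond copula $C_{\rm dia}$ is the cdf of the uniform distribution on $D$ (normalized arc length). The diamond transport $\pi_{\rm dia}\in\Pi(\mu,\nu)$ is the law of $(Q_\mu(U),Q_\nu(V))$ where $(U,V)$ has distribution $C_{\rm dia}$. *)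

(* Defs.v *)
From HB Require Import structures.
From mathcomp Require Import all_boot all_order all_algebra.
From mathcomp Require Import all_classical all_reals all_analysis.
From mathcomp Require Import measurable_realfun ring lra.

Set Implicit Arguments.
Unset Strict Implicit.
Unset Printing Implicit Defensive.

Import Order.TTheory GRing.Theory Num.Theory.
Import numFieldNormedType.Exports.

Local Open Scope classical_set_scope.
Local Open Scope ring_scope.

Section transport_plans.
Context {R : realType}.
Implicit Types (mu nu : probability R R) (pi : probability (R * R)%type R).

(* Measures are compared on measurable sets only: the library leaves their
   values on other sets unconstrained. *)
Definition transport_plans mu nu : set (probability (R * R)%type R) :=
  [set pi | (forall A : set R, measurable A -> pushforward pi fst A = mu A) /\
            (forall B : set R, measurable B -> pushforward pi snd B = nu B)].

Definition same_law pi pi' :=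
  forall A : set (R * R), measurable A -> pi A = pi' A.

Definition rect_cost (p q : R * R) : R := `|(p.1 - q.1) * (p.2 - q.2)|.

(* The energy may be +oo for some plans. *)
Definition rect_energy pi : \bar R :=
  (\int[pi]_p \int[pi]_q (rect_cost p q)%:E)%E.

End transport_plans.

Section quantile.
Context {R : realType}.
Variable mu : probability R R.

(* [inf] is 0 on the empty set and on sets unbounded below, so [quantile] is 0
   wherever the infimum is infinite; this can only happen for t outside ]0, 1[,
   hence with probability 0 for a uniform t. *)
Definition quantile (t : R) : R :=
  inf [set x : R | (t%:E <= mu `]-oo, x]%classic)%E].

Let up (t : R) := [set x : R | (t%:E <= mu `]-oo, x]%classic)%E].

Let up_sub s t : s <= t -> up t `<=` up s.
Proof. by move=> st x; apply: le_trans; rewrite lee_fin. Qed.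

Lemma measurable_quantile : measurable_fun [set: R] quantile.
Proof.
apply: (measurability (@RGenCInfty.G R)) => [|/= _ [_] [r] -> <-].
  exact: RGenCInfty.measurableE.
rewrite setTI.
have mI : measurable [set t | has_inf (up t) /\ r <= quantile t].
  apply: is_interval_measurable => s t [[s0 sb] rs] [[t0 tb] rt] u /andP[su ut].
  have hu : has_inf (up u).
    split; first by apply: subset_nonempty t0; exact: up_sub.
    by case: sb => b sb; exists b => x /(up_sub su)/sb.
  split => //; apply: le_trans rs _; apply: lb_le_inf; first by case: hu.
  by move=> x /(up_sub su) ?; exact: ge_inf.
have mP : measurable [set t | has_inf (up t)].
  apply: is_interval_measurable => s t [s0 sb] [t0 tb] u /andP[su ut].
  split; first by apply: subset_nonempty t0; exact: up_sub.
  by case: sb => b sb; exists b => x /(up_sub su)/sb.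
have -> : quantile @^-1` `[r, +oo[%classic =
    [set t | has_inf (up t) /\ r <= quantile t] `|`
    (~` [set t | has_inf (up t)] `&` [set _ | r <= 0]).
  apply/seteqP; split => t /=; rewrite in_itv/= andbT.
    have [ht rt|nt] := pselect (has_inf (up t)); first by left.
    by rewrite /quantile inf_out// => r0; right.
  by move=> [[]//|[nt]]; rewrite /quantile inf_out.
apply: measurableU => //; apply: measurableI; first exact: measurableC.
have [r0|r0] := boolP (r <= 0).
- by rewrite (_ : [set _ | _] = setT)//; apply/seteqP; split.
- by rewrite (_ : [set _ | _] = set0)//; apply/seteqP; split.
Qed.

End quantile.

Section diamond.
Context {R : realType}.

Definition diamond : set (R * R) :=
  [set p | [/\ 0 <= p.1 <= 1, 0 <= p.2 <= 1 &
               `|p.2 - 1 / 2| + `|p.1 - 1 / 2| = 1 / 2]].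

(* Closed path that starts at (1, 1/2) and runs once along the diamond at
   constant Euclidean speed 2 * sqrt 2, the perimeter: it covers one side in
   each quarter of [0, 1]. *)
Definition diamond_path (s : R) : R * R :=
  (`|2 * s - 1|, `| `|2 * s - 1 / 2| - 1 |).

Let diamond_path_upper (s : R) : 0 <= s <= 1 / 2 ->
  diamond_path s = (1 - 2 * s, 1 - `|2 * s - 1 / 2|).
Proof.
move=> /andP[s0 s1]; have h : `|2 * s - 1 / 2| <= 1 / 2.
  by rewrite ler_norml; apply/andP; split; lra.
by rewrite /diamond_path ler0_norm ?[X in (_, X)]ler0_norm; do ?congr pair; lra.
Qed.

Let diamond_path_lower (s : R) : 1 / 2 <= s <= 1 ->
  diamond_path s = (2 * s - 1, `|2 * s - 3 / 2|).
Proof.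
move=> /andP[s0 s1]; rewrite /diamond_path.
rewrite ger0_norm; last by lra.
rewrite (@ger0_norm _ (2 * s - 1 / 2)); last by lra.
by congr (_, `| _ |); lra.
Qed.

Let half_cases (s : R) : 0 <= s <= 1 -> 0 <= s <= 1 / 2 \/ 1 / 2 <= s <= 1.
Proof.
by move=> /andP[s0 s1]; have [h|h] := lerP s (1 / 2);
  [left|right]; apply/andP; split => //; apply: ltW.
Qed.

Lemma diamond_path_image : diamond_path @` `[0, 1]%classic = diamond.
Proof.
apply/seteqP; split => [_ [s /= + <-]|[x y] []/=].
  rewrite in_itv/= => /half_cases[] h; move: (h) => /andP[s0 s1].
    rewrite diamond_path_upper//; split => /=.
    - by apply/andP; split; lra.
    - have : `|2 * s - 1 / 2| <= 1 / 2 by rewrite ler_norml; lra.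
      by have := normr_ge0 (2 * s - 1 / 2); lra.
    - rewrite (_ : 1 - 2 * s - 1 / 2 = - (2 * s - 1 / 2)); last by lra.
      rewrite normrN ger0_norm; first by lra.
      have : `|2 * s - 1 / 2| <= 1 / 2 by rewrite ler_norml; lra.
      by lra.
  rewrite diamond_path_lower//; split => /=.
  - by apply/andP; split; lra.
  - have : `|2 * s - 3 / 2| <= 1 / 2 by rewrite ler_norml; lra.
    by have := normr_ge0 (2 * s - 3 / 2); lra.
  - rewrite (_ : 2 * s - 1 - 1 / 2 = 2 * s - 3 / 2); last by lra.
    rewrite ler0_norm; first by lra.
    have : `|2 * s - 3 / 2| <= 1 / 2 by rewrite ler_norml; lra.
    by lra.
move=> /andP[x0 x1] _.
have [y2|y2] := lerP (1 / 2) y.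
- move=> xy; exists ((1 - x) / 2); first by rewrite /= in_itv/=; lra.
  rewrite diamond_path_upper; last by lra.
  rewrite (_ : 2 * ((1 - x) / 2) - 1 / 2 = - (x - 1 / 2)); last by lra.
  by rewrite normrN; congr pair; lra.
- move=> xy; exists ((1 + x) / 2); first by rewrite /= in_itv/=; lra.
  rewrite diamond_path_lower; last by lra.
  rewrite (_ : 2 * ((1 + x) / 2) - 3 / 2 = x - 1 / 2); last by lra.
  by congr pair; lra.
Qed.

Lemma diamond_path_inj : {in `[0, 1[ &, injective diamond_path}.
Proof.
have upper_lower (s t : R) : 0 <= s <= 1 / 2 -> 1 / 2 <= t < 1 ->
    diamond_path s = diamond_path t -> s = t.
  move=> hs /andP[t0 t1]; move: (hs) => /andP[s0 s1].
  rewrite diamond_path_upper// diamond_path_lower; last by lra.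
  move=> [e1]; rewrite (_ : 2 * t - 3 / 2 = - (2 * s - 1 / 2)); last by lra.
  rewrite normrN => e2; have : `|2 * s - 1 / 2| = 1 / 2 by lra.
  have [h|h] := lerP 0 (2 * s - 1 / 2).
    by rewrite ger0_norm//; lra.
  by rewrite ltr0_norm//; lra.
move=> s t; rewrite !in_itv/= => /andP[s0 s1] /andP[t0 t1].
have [hs|hs] := lerP s (1 / 2); have [ht|ht] := lerP t (1 / 2).
- by rewrite !diamond_path_upper ?s0 ?t0// => -[e _]; lra.
- by apply: upper_lower; rewrite ?s0 ?hs ?t1 ?(ltW ht).
- by move/esym => e; apply/esym; apply: upper_lower e;
    rewrite ?t0 ?ht ?s1 ?(ltW hs).
- rewrite !diamond_path_lower ?(ltW hs) ?(ltW ht) ?(ltW s1) ?(ltW t1)//.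
  by move=> -[e _]; lra.
Qed.

Lemma diamond_path_speed (k : 'I_4) (s t : R) :
  s \in `[k%:R / 4, (k%:R + 1) / 4] -> t \in `[k%:R / 4, (k%:R + 1) / 4] ->
  Num.sqrt (((diamond_path s).1 - (diamond_path t).1) ^+ 2 +
            ((diamond_path s).2 - (diamond_path t).2) ^+ 2) =
  2 * Num.sqrt 2 * `|s - t|.
Proof.
move=> hs ht.
have [e1 e2] : ((diamond_path s).1 - (diamond_path t).1) ^+ 2 =
      (2 * (s - t)) ^+ 2 /\
    ((diamond_path s).2 - (diamond_path t).2) ^+ 2 = (2 * (s - t)) ^+ 2.
  case: k hs ht => -[|[|[|[|//]]]] ? hs ht; rewrite in_itv/= in hs;
    rewrite in_itv/= in ht; case/andP: hs ht => s0 s1 /andP[t0 t1].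
  - rewrite !diamond_path_upper/=; [|lra|lra].
    by rewrite !ler0_norm; [split; ring|lra|lra].
  - rewrite !diamond_path_upper/=; [|lra|lra].
    by rewrite !ger0_norm; [split; ring|lra|lra].
  - rewrite !diamond_path_lower/=; [|lra|lra].
    by rewrite !ler0_norm; [split; ring|lra|lra].
  - rewrite !diamond_path_lower/=; [|lra|lra].
    by rewrite !ger0_norm; [split; ring|lra|lra].
rewrite e1 e2.
have -> : (2 * (s - t)) ^+ 2 + (2 * (s - t)) ^+ 2 = 2 * (2 * (s - t)) ^+ 2.
  by ring.
by rewrite sqrtrM// sqrtr_sqr normrM normr_nat mulrCA mulrA.
Qed.

Lemma measurable_diamond_path : measurable_fun [set: R] diamond_path.
Proof.
apply: measurable_fun_pair.
- by apply: measurableT_comp => //; exact: measurable_funB.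
- by do 2 (apply: measurableT_comp => //; apply: measurable_funB => //).
Qed.

(* [uniform_prob] lives on [measurableTypeR R], a copy of R with the same
   (Borel) measurable sets. *)
Definition diamond_map : measurableTypeR R -> R * R := diamond_path.

HB.instance Definition _ :=
  isMeasurableFun.Build _ _ _ _ diamond_map measurable_diamond_path.

(* Uniform distribution on the diamond: since [diamond_path] is injective on
   [0, 1[ and has constant speed, the image of the uniform law on [0, 1] is the
   normalized arc length.  Its cdf is the diamond copula. *)
Definition diamond_law : probability (R * R)%type R :=
  distribution (uniform_prob (@ltr01 R)) diamond_map.

Variables mu nu : probability R R.

Definition quantile_pair (p : R * R) : R * R :=
  (quantile mu p.1, quantile nu p.2).

Lemma measurable_quantile_pair : measurable_fun [set: R * R] quantile_pair.
Proof.
by apply: measurable_fun_pair; apply: measurableT_comp => //;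
  exact: measurable_quantile.
Qed.

HB.instance Definition _ :=
  isMeasurableFun.Build _ _ _ _ quantile_pair measurable_quantile_pair.

Definition diamond_transport : probability (R * R)%type R :=
  distribution diamond_law quantile_pair.

End diamond.

(* Main.v *)
From HB Require Import structures.
Require Import Defs.
From mathcomp Require Import all_boot all_order all_algebra.
From mathcomp Require Import all_classical all_reals all_analysis.
From mathcomp Require Import measurable_realfun ring lra.

Import Order.TTheory GRing.Theory Num.Theory.
Import numFieldNormedType.Exports.

Local Open Scope classical_set_scope.
Local Open Scope ring_scope.

(** The distance |x - x'| is the length of the set of thresholds a that
    separate x from x', so the rectangular cost is the area of the set of pairs
    (a, b) for which a separates the abscissas and b the ordinates.  By Tonelli,
    the energy of a plan is the integral over (a, b) of the probability that two
    independent draws are separated by both thresholds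
    ([rect_energy_crossing_sets]).  The two thresholds cut the plane into four
    cells, and both separate the draws exactly when these lie in opposite cells.
    The probabilities of the four cells are determined by u = F(a), v = G(b) and
    the joint cdf h = H(a, b), so the integrand is a function [crossing u v h]
    that depends on the plan through h only ([rect_energyE]).

    Now [crossing u v] is a quadratic polynomial in h with leading coefficient
    4, and h ranges over the Frechet-Hoeffding interval
    [max(0, u + v - 1), min(u, v)].  Its minimum there is the truncation to that
    interval of the vertex (u + v) / 2 - 1 / 4, and this truncation is the cdf
    of the uniform law on the diamond ([diamond_law_rect]).  The diamond
    transport has the joint cdf [diamond_copula (F a) (G b)], so it minimizes
    the integrand at every (a, b), hence minimizes the energy.

    For uniqueness, strong convexity bounds the excess of the integrand from
    below by four times the squared difference of the joint cdfs
    ([crossing_diamond_copula_min]).  The minimal energy is finite, because the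
    integrand of the diamond transport is at most that of the product plan,
    4 F (1 - F) G (1 - G), and F (1 - F) is integrable when the first moment is
    finite.  So another minimizer has the same joint cdf at almost every (a, b),
    then everywhere by monotonicity and right continuity
    ([eq_joint_cdf_of_ae]), and a law on the plane is determined by its joint
    cdf. *)

(** * The pointwise minimization problem *)

Section pointwise.
Context {R : realType}.
Implicit Types u v h : R.

(** The probability that two independent draws lie in opposite cells, when the
    four cells have probabilities h, u - h, v - h and 1 - u - v + h. *)
Definition crossing u v h := 2 * (h * (1 - u - v + h) + (u - h) * (v - h)).

(** The vertex (u + v) / 2 - 1 / 4 of the parabola [crossing u v], truncated to
    the Frechet-Hoeffding bounds; [diamond_law_rect] identifies it with the cdf
    of the uniform law on the diamond. *)
Definition diamond_copula u v :=
  Num.max (Num.max 0 (u + v - 1)) (Num.min (Num.min u v) ((u + v) / 2 - 1 / 4)).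

(** At the minimum h0 of a quadratic with leading coefficient 4 over an
    interval, the derivative at h0 times (h - h0) is nonnegative, and the rest
    of the difference is exactly 4 (h - h0)^2. *)
Lemma crossing_diamond_copula_min u v h :
  0 <= h -> u + v - 1 <= h -> h <= u -> h <= v ->
  crossing u v (diamond_copula u v) + 4 * (h - diamond_copula u v) ^+ 2
    <= crossing u v h.
Proof.
move=> h0 hw hu hv.
(* The second factor is the derivative of [crossing u v] at the minimum. *)
have : 0 <= (h - diamond_copula u v) *
            (8 * diamond_copula u v + 2 - 4 * u - 4 * v).
  rewrite /diamond_copula.
  have [?|?] := leP 0 (u + v - 1); have [?|?] := leP u v;
  (have [?|?] := leP u ((u + v) / 2 - 1 / 4));
  (have [?|?] := leP v ((u + v) / 2 - 1 / 4));
  repeat (match goal with |- context [Num.max ?a ?b] => have [?|?] := leP a b end);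
  first [exfalso; lra | by apply: mulr_ge0; lra
        | by apply: mulr_le0; lra
        | by rewrite [X in _ * X](_ : _ = 0) ?mulr0//; field].
rewrite /crossing; nra.
Qed.

Lemma crossing_ge0 u v h :
  0 <= h -> u + v - 1 <= h -> h <= u -> h <= v -> 0 <= crossing u v h.
Proof.
move=> h0 hw hu hv; rewrite /crossing mulr_ge0// addr_ge0//.
  by rewrite mulr_ge0//; lra.
by rewrite mulr_ge0//; lra.
Qed.

(** The value h = u v is the joint cdf of the product plan. *)
Lemma crossing_indep u v : crossing u v (u * v) = 4 * (u * (1 - u)) * (v * (1 - v)).
Proof. by rewrite /crossing; ring. Qed.

End pointwise.

(** * The energy as an integral over pairs of thresholds *)

Section straddling.
Context {R : realType}.

Definition straddle (x x' a : R) : bool := (x <= a) (+) (x' <= a).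

Lemma straddle_set x x' :
  [set a | straddle x x' a] = `[Num.min x x', Num.max x x'[%classic.
Proof.
apply/seteqP; split => a /=; rewrite in_itv/= /straddle ge_min lt_max;
  case: (leP x a) => //=; case: (leP x' a) => //=.
Qed.

Lemma lebesgue_straddle x x' :
  lebesgue_measure [set a | straddle x x' a] = `|x - x'|%:E.
Proof.
rewrite straddle_set lebesgue_measure_itv/= lte_fin.
have [xx|xx] := leP x x'; case: ltP => // h.
- by rewrite EFinN -EFinD ler0_norm ?opprB//; lra.
- by rewrite (_ : x - x' = 0) ?normr0//; lra.
- by rewrite EFinN -EFinD gtr0_norm//; lra.
- by move: h; rewrite leNgt xx.
Qed.

End straddling.

Section thresholds.
Context {R : realType}.
Implicit Types (pi : probability (R * R)%type R) (p q : R * R).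

Let rT := measurableTypeR R.

(** Thresholds range over the copy of the line that carries the Lebesgue
    measure. *)
Definition leb : {sigma_finite_measure set rT -> \bar R} := @lebesgue_measure R.
(** A constant of its own, which carries a sigma-finite structure. *)
Definition leb2 : set (rT * rT) -> \bar R := (leb \x leb)%E.

HB.instance Definition _ := Measure.on leb2.

Let leb2_sigma_finite : sigma_finite setT leb2.
Proof.
have /sigma_finiteP[F [TF ndF Foo]] := sigma_finiteT leb.
exists (fun n => F n `*` F n); last first.
  move=> n; have [mF Fn] := Foo n; split; first exact: measurableX.
  rewrite [ltLHS](product_measure1E leb leb mF mF).
  by rewrite lte_mul_pinfty// ge0_fin_numE.
rewrite -setXTT TF; apply/seteqP; split; last first.
  by move=> [x y] [n _ []/= ? ?]; split; exists n.
move=> [x y] [/= [n _ Fnx] [k _ Gky]]; exists (maxn n k) => //; split.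
- by move: x Fnx; exact/subsetPset/ndF/leq_maxl.
- by move: y Gky; exact/subsetPset/ndF/leq_maxr.
Qed.

HB.instance Definition _ := Measure_isSigmaFinite.Build _ _ _ leb2
  leb2_sigma_finite.

Definition straddle_graph : set (((R * R) * (R * R)) * (rT * rT)) :=
  [set w | straddle w.1.1.1 w.1.2.1 w.2.1 && straddle w.1.1.2 w.1.2.2 w.2.2].

Lemma measurable_straddle d (T : measurableType d) (f g h : T -> R) :
  measurable_fun setT f -> measurable_fun setT g -> measurable_fun setT h ->
  measurable_fun setT (fun t => straddle (f t) (g t) (h t)).
Proof.
move=> mf mg mh; rewrite (_ : (fun t => _) =
   fun t => (f t <= h t) && ~~ (g t <= h t) || ~~ (f t <= h t) && (g t <= h t)).
  by apply: measurable_or; apply: measurable_and; try (apply: measurable_neg);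
     apply: measurable_fun_ler.
by apply/funext => t; rewrite /straddle; case: (f t <= h t); case: (g t <= h t).
Qed.

Lemma measurable_straddle_graph : measurable straddle_graph.
Proof.
rewrite -[X in measurable X]setTI.
apply: measurable_and => //; apply: measurable_straddle.
all: do ?apply: measurableT_comp => //.
Qed.

Lemma rect_cost_straddle (z : (R * R) * (R * R)) :
  (rect_cost z.1 z.2)%:E = leb2 (xsection straddle_graph z).
Proof.
rewrite (_ : xsection _ _ = [set a | straddle z.1.1 z.2.1 a] `*`
                            [set b | straddle z.1.2 z.2.2 b]); last first.
  by apply/seteqP; split => ab; rewrite /xsection/= inE /straddle_graph/=;
    [move/andP | move=> ?; apply/andP].
rewrite /leb2 product_measure1E; [|by rewrite straddle_set|by rewrite straddle_set].
by rewrite /rect_cost normrM EFinM; congr (_ * _)%E;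
  rewrite -lebesgue_straddle.
Qed.

Lemma measurable_rect_cost :
  measurable_fun setT (fun z : (R * R) * (R * R) => rect_cost z.1 z.2).
Proof.
have m1 (f : (R * R) * (R * R) -> R * R) : measurable_fun setT f ->
    measurable_fun setT (fst \o f) by exact: measurableT_comp.
have m2 (f : (R * R) * (R * R) -> R * R) : measurable_fun setT f ->
    measurable_fun setT (snd \o f) by exact: measurableT_comp.
apply: measurableT_comp => //; apply: measurable_funM; apply: measurable_funB.
- exact: (m1 fst).
- exact: (m1 snd).
- exact: (m2 fst).
- exact: (m2 snd).
Qed.

(** Tonelli on the indicator of [straddle_graph]: one order of integration gives
    the cost by [rect_cost_straddle], the other gives for each pair of
    thresholds the probability that both separate two independent draws. *)
Lemma rect_energy_crossing_sets pi :
  (rect_energy pi = \int[leb2]_ab (pi \x pi) (ysection straddle_graph ab))%E.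
Proof.
rewrite /rect_energy.
pose c (z : (R * R) * (R * R)) := (rect_cost z.1 z.2)%:E.
rewrite -[LHS](@fubini_tonelli1 _ _ _ _ _ pi pi c); last 2 first.
- apply: measurableT_comp; first exact: EFin_measurable.
  exact: measurable_rect_cost.
- by move=> z; rewrite lee_fin; exact: normr_ge0.
rewrite /c {c}.
under eq_integral do rewrite rect_cost_straddle.
have mS := measurable_straddle_graph.
transitivity (\int[pi \x pi]_z fubini_F leb2 (EFin \o \1_straddle_graph) z)%E.
  by rewrite indic_fubini_tonelli_FE.
pose P : probability ((R * R) * (R * R))%type R := (pi \x pi)%E.
rewrite [LHS](@indic_fubini_tonelli _ _ _ _ _ P leb2 _ mS).
by rewrite indic_fubini_tonelli_GE.
Qed.

End thresholds.

Section four_cells.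
Context {R : realType} {d} {T : measurableType d} (P : probability T R).
Variables (A B : set T) (mA : measurable A) (mB : measurable B).
Let p (X : set T) : R := fine (P X).

Let PE (X : set T) : measurable X -> P X = (p X)%:E.
Proof. by move=> mX; rewrite fineK// fin_num_measure. Qed.

Let pD (X Y : set T) : measurable X -> measurable Y -> p (X `\` Y) = p X - p (X `&` Y).
Proof.
move=> mX mY; apply: EFin_inj.
rewrite -PE ?EFinB -?PE//; [|exact: measurableI|exact: measurableD].
by rewrite measureD// -ge0_fin_numE// fin_num_measure.
Qed.

Lemma probability_both_out :
  p (~` A `&` ~` B) = 1 - p A - p B + p (A `&` B).
Proof.
have pA : p (~` A) = 1 - p A.
  have := pD _ _ measurableT mA; rewrite setTD setTI => ->.
  by congr (_ - _); rewrite /p probability_setT.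
have -> : ~` A `&` ~` B = ~` A `\` B by rewrite setDE.
rewrite pD ?pA//; last exact: measurableC.
have -> : ~` A `&` B = B `\` A by rewrite setDE setIC.
by rewrite pD// [B `&` A]setIC; ring.
Qed.

Lemma probability_setI_bounds :
  [/\ 0 <= p (A `&` B), p A + p B - 1 <= p (A `&` B),
      p (A `&` B) <= p A & p (A `&` B) <= p B].
Proof.
have p0 X : 0 <= p X by exact: fine_ge0.
split => //.
- by have := p0 (~` A `&` ~` B); rewrite probability_both_out; lra.
- by have := p0 (A `\` B); rewrite pD//; lra.
- by have := p0 (B `\` A); rewrite pD// setIC; lra.
Qed.

(** The pairs of points that A separates and B separates, written as a disjoint
    union of products of opposite cells. *)
Definition crossing_set : set (T * T) :=
  ((A `&` B) `*` (~` A `&` ~` B) `|` (~` A `&` ~` B) `*` (A `&` B)) `|`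
  ((A `\` B) `*` (B `\` A) `|` (B `\` A) `*` (A `\` B)).

Lemma product_crossing_set :
  (P \x P)%E crossing_set = (crossing (p A) (p B) (p (A `&` B)))%:E.
Proof.
pose PP : {measure set (T * T)%type -> \bar R} := (P \x P)%E.
have mAB : measurable (A `&` B) by exact: measurableI.
have mCC : measurable (~` A `&` ~` B) by apply: measurableI; exact: measurableC.
have mAD : measurable (A `\` B) by exact: measurableD.
have mBD : measurable (B `\` A) by exact: measurableD.
have prodE (X Y : set T) : measurable X -> measurable Y ->
    PP (X `*` Y) = (p X * p Y)%:E.
  by move=> mX mY; rewrite [LHS]product_measure1E// EFinM -!PE.
have -> : (P \x P)%E crossing_set =
    (PP ((A `&` B) `*` (~` A `&` ~` B)) + PP ((~` A `&` ~` B) `*` (A `&` B)) +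
    (PP ((A `\` B) `*` (B `\` A)) + PP ((B `\` A) `*` (A `\` B))))%E.
  rewrite -[LHS]/(PP crossing_set) /crossing_set measureU; first last.
  - by apply/seteqP; split => // -[x y] /=; rewrite /setD/=; tauto.
  - by apply: measurableU; exact: measurableX.
  - by apply: measurableU; exact: measurableX.
  rewrite measureU; first last.
  - by apply/seteqP; split => // -[x y] /=; tauto.
  - exact: measurableX.
  - exact: measurableX.
  rewrite measureU//; [exact: measurableX|exact: measurableX|].
  by apply/seteqP; split => // -[x y] /=; rewrite /setD/=; tauto.
rewrite !prodE// -!EFinD probability_both_out !pD// (setIC B A) /crossing.
by congr EFin; ring.
Qed.

End four_cells.

Section energy.
Context {R : realType}.
Implicit Types (mu nu : probability R R) (pi : probability (R * R)%type R).

Definition marginal_cdf mu (a : R) : R := fine (mu `]-oo, a]%classic).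
Definition joint_cdf pi (a b : R) : R :=
  fine (pi (`]-oo, a]%classic `*` `]-oo, b]%classic)).

Lemma ysection_straddle_graph (a b : R) :
  ysection straddle_graph (a, b) =
  crossing_set (fst @^-1` `]-oo, a]%classic) (snd @^-1` `]-oo, b]%classic).
Proof.
apply/seteqP; split => -[p q];
  rewrite /ysection/= inE /straddle_graph/crossing_set/straddle/setD/= !in_itv/=.
  by case: (p.1 <= a); case: (q.1 <= a); case: (p.2 <= b); case: (q.2 <= b);
    rewrite //=; intuition.
by case: (p.1 <= a); case: (q.1 <= a); case: (p.2 <= b); case: (q.2 <= b);
    rewrite //=; intuition.
Qed.

Lemma measurable_fst_preimage (A : set R) : measurable A ->
  measurable (fst @^-1` A : set (R * R)).
Proof. by move=> mA; rewrite -[X in measurable X]setTI; exact: measurable_fst. Qed.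

Lemma measurable_snd_preimage (A : set R) : measurable A ->
  measurable (snd @^-1` A : set (R * R)).
Proof. by move=> mA; rewrite -[X in measurable X]setTI; exact: measurable_snd. Qed.

Lemma rect_energyE mu nu pi : transport_plans mu nu pi ->
  rect_energy pi = (\int[leb2]_ab (crossing (marginal_cdf mu ab.1)
     (marginal_cdf nu ab.2) (joint_cdf pi ab.1 ab.2))%:E)%E.
Proof.
move=> [pi1 pi2]; rewrite rect_energy_crossing_sets.
apply: eq_integral => -[a b] _; rewrite ysection_straddle_graph.
rewrite product_crossing_set; last 2 first.
- exact: measurable_fst_preimage.
- exact: measurable_snd_preimage.
by rewrite /marginal_cdf -pi1// -pi2.
Qed.

Lemma joint_cdf_bounds mu nu pi a b : transport_plans mu nu pi ->
  [/\ 0 <= joint_cdf pi a b,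
      marginal_cdf mu a + marginal_cdf nu b - 1 <= joint_cdf pi a b,
      joint_cdf pi a b <= marginal_cdf mu a &
      joint_cdf pi a b <= marginal_cdf nu b].
Proof.
move=> [pi1 pi2]; rewrite /marginal_cdf -pi1// -pi2//.
by apply: probability_setI_bounds;
  [exact: measurable_fst_preimage|exact: measurable_snd_preimage].
Qed.

End energy.

(** * Marginal cdfs and quantiles *)

Section quantile.
Context {R : realType}.
Variable mu : probability R R.

Lemma marginal_cdfE a : mu `]-oo, a]%classic = (marginal_cdf mu a)%:E.
Proof. by rewrite /marginal_cdf fineK// fin_num_measure. Qed.

Lemma marginal_cdf01 a : 0 <= marginal_cdf mu a <= 1.
Proof. by rewrite -!lee_fin -marginal_cdfE measure_ge0 probability_le1. Qed.

Lemma le_marginal_cdf a b : a <= b -> marginal_cdf mu a <= marginal_cdf mu b.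
Proof.
move=> ab; rewrite -lee_fin -!marginal_cdfE le_measure ?inE//.
exact: subset_itvl.
Qed.

Let idR : R -> R := idfun.
#[local] HB.instance Definition _ :=
  @isMeasurableFun.Build _ _ _ _ idR (@measurable_id _ _ setT).

Lemma cvg_marginal_cdfy : marginal_cdf mu @ +oo --> (1 : R).
Proof. exact/fine_cvg/(@cvg_cdfy1 _ _ _ mu idR). Qed.

Lemma cvg_marginal_cdfNy : marginal_cdf mu @ -oo --> (0 : R).
Proof. exact/fine_cvg/(@cvg_cdfNy0 _ _ _ mu idR). Qed.

Lemma marginal_cdf_right_continuous a :
  marginal_cdf mu @ a^'+ --> marginal_cdf mu a.
Proof.
apply: fine_cvg; rewrite -marginal_cdfE.
exact: (@cdf_right_continuous _ _ _ mu idR a).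
Qed.

(** The Galois connection between quantile and cdf.  For t strictly between 0
    and 1 the set defining the quantile is nonempty and bounded below, so its
    infimum is a genuine one, and right continuity shows that it is attained. *)
Lemma quantile_le t a : 0 < t < 1 -> (quantile mu t <= a) = (t <= marginal_cdf mu a).
Proof.
move=> /andP[t0 t1].
pose up := [set x : R | (t%:E <= mu `]-oo, x]%classic)%E].
have upE x : up x <-> t <= marginal_cdf mu x.
  by rewrite /up/= marginal_cdfE lee_fin.
have up0 : up !=set0.
  have /filter_ex[x tx] : \forall x \near +oo, t < marginal_cdf mu x.
    exact: cvgr_gt cvg_marginal_cdfy _ t1.
  by exists x; apply/upE; exact: ltW.
have uplb : has_lbound up.
  have /filter_ex[x xt] : \forall x \near -oo, marginal_cdf mu x < t.
    exact: cvgr_lt cvg_marginal_cdfNy _ t0.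
  exists x => y /upE ty; rewrite leNgt; apply/negP => yx.
  by have := le_marginal_cdf _ _ (ltW yx); lra.
apply/idP/idP => [qa|ta]; last by apply: ge_inf => //; exact/upE.
rewrite leNgt; apply/negP => Fat.
have h : \forall x \near a^'+, (marginal_cdf mu x < t) && (a < x).
  near=> x; apply/andP; split; last by near: x; exact: nbhs_right_gt.
  near: x; exact: cvgr_lt (marginal_cdf_right_continuous a) _ Fat.
have [x /andP[Fxt ax]] := @filter_ex _ _ (at_right_proper_filter a) _ h.
have : quantile mu t < x by exact: le_lt_trans ax.
move=> /(inf_lt up0)[y /upE ty yx].
by have := le_marginal_cdf _ _ (ltW yx); lra.
Unshelve. all: by end_near. Qed.

Lemma measurable_quantile_sublevel a :
  measurable (quantile mu @^-1` `]-oo, a]%classic).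
Proof. by rewrite -[X in measurable X]setTI; exact: measurable_quantile. Qed.

Lemma quantile_sublevel a t : 0 < t < 1 ->
  (quantile mu @^-1` `]-oo, a]%classic) t <-> t <= marginal_cdf mu a.
Proof. by move=> t01; rewrite /= in_itv/= quantile_le. Qed.

End quantile.

(** * The cdf of the uniform law on the diamond *)

Section diamond_law.
Context {R : realType}.

Lemma uniform_prob01E (A : set R) : measurable A ->
  uniform_prob (@ltr01 R) A = lebesgue_measure (A `&` `[0, 1]%classic).
Proof.
move=> mA; rewrite /uniform_prob integral_uniform_pdf.
rewrite (eq_integral (fun=> 1%E)); last first.
  move=> x; rewrite inE => -[_ /=]; rewrite in_itv/= /uniform_pdf => ->.
  by rewrite subr0 invr1.
by rewrite integral_cst ?mul1e//; exact: measurableI.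
Qed.

Lemma lebesgue_eq_off_finite (X Y N : set R) : measurable X -> measurable Y ->
  finite_set N -> X `\` N = Y `\` N ->
  lebesgue_measure X = lebesgue_measure Y.
Proof.
move=> mX mY fN XY.
have mN : measurable N by exact/countable_measurable/finite_set_countable.
have N0 : lebesgue_measure N = 0%E.
  exact/countable_lebesgue_measure0/finite_set_countable.
suff E Z : measurable Z -> lebesgue_measure Z = lebesgue_measure (Z `\` N).
  by rewrite E// XY -E.
move=> mZ; rewrite (measureDI _ mZ mN) [X in (_ + X)%E](_ : _ = 0%E) ?adde0//.
apply/eqP; rewrite eq_le measure_ge0 andbT -N0 le_measure ?inE//.
exact: measurableI.
Qed.

Lemma diamond_path_fst_le (s u : R) :
  (diamond_path s).1 <= u <-> (1 - u) / 2 <= s <= (1 + u) / 2.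
Proof. by rewrite /diamond_path/= ler_norml; split => /andP[? ?]; lra. Qed.

Lemma diamond_path_snd_le (s v : R) : 0 <= s <= 1 -> 0 <= v <= 1 ->
  (diamond_path s).2 <= v <->
  (3 / 2 - v) / 2 <= s <= (3 / 2 + v) / 2 \/ s <= (v - 1 / 2) / 2.
Proof.
move=> /andP[s0 s1] /andP[v0 v1]; rewrite /diamond_path/= ler_norml.
case: (ger0P (2 * s - 1 / 2)) => h; split.
- by move=> /andP[? ?]; left; lra.
- by case=> [/andP[? ?]|?]; apply/andP; split; lra.
- by move=> /andP[? ?]; right; lra.
- by case=> [/andP[? ?]|?]; apply/andP; split; lra.
Qed.

(** The path meets the boundary of the unit square at the four vertices of the
    diamond only, at times that are multiples of 1/4. *)
Lemma diamond_path_interior (s : R) : 0 <= s <= 1 ->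
  s \notin [:: 0; 1 / 4; 1 / 2; 3 / 4; 1] ->
  0 < (diamond_path s).1 < 1 /\ 0 < (diamond_path s).2 < 1.
Proof.
move=> /andP[s0 s1]; rewrite !inE !negb_or => /and5P[n0 n1 n2 n3 n4].
have e1 : 0 < s by rewrite lt_neqAle eq_sym n0.
have e2 : s < 1 by rewrite lt_neqAle n4.
rewrite /diamond_path/=; split.
  rewrite normr_gt0 ltr_norml; apply/andP; split; last by apply/andP; split; lra.
  by apply: contra n2 => /eqP ?; apply/eqP; lra.
rewrite normr_gt0 ltr_norml; apply/andP; split.
  apply: contra n3 => /eqP h; apply/eqP.
  by move: h; case: (ger0P (2 * s - 1 / 2)) => ? ?; lra.
have h : 2 * s - 1 / 2 != 0 by apply: contra n1 => /eqP ?; apply/eqP; lra.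
have : 0 < `|2 * s - 1 / 2| by rewrite normr_gt0.
have : `|2 * s - 1 / 2| < 2 by rewrite ltr_norml; apply/andP; split; lra.
by move=> ? ?; apply/andP; split; lra.
Qed.

(** The two terms are the lengths of the two time intervals during which the
    path stays in the lower left rectangle with corner (u, v). *)
Lemma diamond_copula_lengths (u v : R) : u <= 1 -> v <= 1 ->
  diamond_copula u v =
  Num.max 0 (Num.min ((1 + u) / 2) ((3 / 2 + v) / 2) -
             Num.max ((1 - u) / 2) ((3 / 2 - v) / 2)) +
  Num.max 0 ((v - 1 / 2) / 2 - (1 - u) / 2).
Proof.
move=> u1 v1; rewrite /diamond_copula.
have [?|?] := leP u v; have [?|?] := leP ((1 - u) / 2) ((3 / 2 - v) / 2);
(have [?|?] := leP ((1 + u) / 2) ((3 / 2 + v) / 2)); try (exfalso; lra);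
(have [?|?] := leP 0 (u + v - 1));
repeat (match goal with |- context [Num.min ?a ?b] => have [?|?] := leP a b end);
repeat (match goal with |- context [Num.max ?a ?b] => have [?|?] := leP a b end);
lra.
Qed.

(** The sets X and Y are prescribed inside the open unit interval only, which
    suits sublevel sets of quantiles, whose behaviour at 0 and 1 is arbitrary.
    In time, the event is the union of two intervals up to finitely many
    instants, and the law of the time is uniform. *)
Lemma diamond_law_rect (X Y : set R) u v : measurable X -> measurable Y ->
  0 <= u <= 1 -> 0 <= v <= 1 ->
  (forall t, 0 < t < 1 -> X t <-> t <= u) ->
  (forall t, 0 < t < 1 -> Y t <-> t <= v) ->
  diamond_law (X `*` Y) = (diamond_copula u v)%:E.
Proof.
move=> mX mY /andP[u0 u1] /andP[v0 v1] Xu Yv.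
have mXY : measurable (diamond_map @^-1` (X `*` Y) : set R).
  rewrite -[X in measurable X]setTI.
  by apply: measurable_diamond_path => //; exact: measurableX.
rewrite [LHS]/= /pushforward uniform_prob01E//.
pose l := Num.max ((1 - u) / 2) ((3 / 2 - v) / 2).
pose r := Num.min ((1 + u) / 2) ((3 / 2 + v) / 2).
pose e := (v - 1 / 2) / 2.
(* The ordinate goes up from 1 / 2 to 1, down to 0 and up again to 1 / 2.  The
   path is in the rectangle during [l, r], around the minimum of the ordinate,
   and during [(1 - u) / 2, e], on the first ascending side.  The excluded
   instants are those of the vertices, and the endpoint e of the half-open
   interval. *)
have le1 : e <= l by rewrite /e /l le_max; apply/orP; right; lra.
have e1 : e <= 1 by rewrite /e; lra.
have l0 : (1 - u) / 2 <= l by rewrite /l le_max lexx.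
have r1 : r <= (1 + u) / 2 by rewrite /r ge_min lexx.
rewrite (@lebesgue_eq_off_finite _ (`[l, r]%classic `|` `[(1 - u) / 2, e[%classic)
   [set` [:: 0; 1/4; 1/2; 3/4; 1; e]]); last 4 first.
- by apply: measurableI.
- by apply: measurableU.
- exact: finite_seq.
- have key s : 0 <= s <= 1 -> s \notin [:: 0; 1/4; 1/2; 3/4; 1; e] ->
      (X (diamond_path s).1 /\ Y (diamond_path s).2) <->
      (l <= s <= r \/ (1 - u) / 2 <= s < e).
    move=> s01 sN.
    have se : s != e by apply: contra sN; rewrite !inE => ->; rewrite !orbT.
    have [/Xu -> /Yv ->] : 0 < (diamond_path s).1 < 1 /\ 0 < (diamond_path s).2 < 1.
      apply: diamond_path_interior => //; apply: contra sN.
      by rewrite !inE => /or4P[|||/orP[]] ->; rewrite ?orbT.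
    rewrite diamond_path_fst_le diamond_path_snd_le ?v0//.
    rewrite /l /r ge_max le_min; split.
      move=> [/andP[-> ->]] [/andP[-> ->]|se']; first by left.
      by right; rewrite lt_neqAle se.
    move=> [/andP[/andP[-> ->] /andP[-> ->]]|/andP[h1 h2]]; first by split => //; left.
    split; last by right; exact: ltW.
    by rewrite h1/=; move: h2; rewrite /e; lra.
  apply/seteqP; split => s [h sN]; split => //.
  + case: h => -[/= Xs Ys]; rewrite in_itv/= => s01; rewrite !in_itv/=.
    by apply/(key s s01); last split => //; apply/negP.
  + have s01 : 0 <= s <= 1.
      by case: h; rewrite /= in_itv/= => /andP[? ?]; apply/andP; split; lra.
    split; last by rewrite /= in_itv/=.
    by apply/(key s s01); [exact/negP|move: h; rewrite /= !in_itv].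
rewrite measureU//=; last first.
  apply/seteqP; split => // s []/=; rewrite !in_itv/= => /andP[? _] /andP[_ ?].
  by lra.
rewrite !lebesgue_measure_itv/= !lte_fin.
rewrite diamond_copula_lengths// -/l -/r -/e EFinD; congr (_ + _)%E.
  by case: ltP => h; case: leP => h2 //; rewrite ?EFinN -?EFinD; congr EFin; lra.
by case: ltP => h; case: leP => h2 //; rewrite ?EFinN -?EFinD; congr EFin; lra.
Qed.

End diamond_law.

(** * Laws determined by their cdfs *)

Section laws.
Context {R : realType}.

(** Stated for two functions on two finite measure spaces, so that it applies
    both to a marginal compared with a law on the line and to one coordinate
    under a law restricted by a condition on the other coordinate. *)
Lemma eq_law_of_rays d1 d2 (T1 : measurableType d1) (T2 : measurableType d2)
    (m1 : {measure set T1 -> \bar R}) (m2 : {measure set T2 -> \bar R})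
    (f1 : T1 -> R) (f2 : T2 -> R) :
  measurable_fun setT f1 -> measurable_fun setT f2 ->
  (m1 setT < +oo)%E -> m1 setT = m2 setT ->
  (forall x, m1 (f1 @^-1` `]-oo, x]%classic) = m2 (f2 @^-1` `]-oo, x]%classic)) ->
  forall A, measurable A -> m1 (f1 @^-1` A) = m2 (f2 @^-1` A).
Proof.
move=> mf1 mf2 fin1 mT mray A mA; have fin2 := fin1; rewrite mT in fin2.
(* The measure structure of a push-forward depends on the proof of measurability. *)
pose p1 := measure_function_pushforward__canonical__measure_function_Measure m1 mf1.
pose p2 := measure_function_pushforward__canonical__measure_function_Measure m2 mf2.
suff : p1 A = p2 A by [].
apply: (measure_unique (@RGenOInfty.G R) (fun n => `](- n%:R), +oo[%classic)) => //.
- exact: RGenOInfty.measurableE.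
- move=> _ _ [x ->] [y ->]; exists (Num.max x y); apply/seteqP; split => z /=;
    by rewrite !in_itv/= !andbT gt_max => /andP.
- by move=> n; exists (- n%:R).
- rewrite -subTset => x _; exists (Num.truncn `|x|).+1 => //=.
  rewrite in_itv/= andbT ltrNl (le_lt_trans _ (Num.Theory.truncnS_gt _))//.
  by rewrite -normrN ler_norm.
- move=> _ [x ->]; rewrite -setCitvl.
  have tail d (T : measurableType d) (m : {measure set T -> \bar R}) (f : T -> R) :
      measurable_fun setT f -> (m setT < +oo)%E ->
      m (f @^-1` (~` `]-oo, x]%classic)) = (m setT - m (f @^-1` `]-oo, x]%classic))%E.
    move=> mf fin; have mX : measurable (f @^-1` `]-oo, x]%classic).
      by rewrite -[X in measurable X]setTI; exact: mf.
    suff compl X : measurable X -> m (~` X) = (m setT - m X)%E by exact: compl.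
    by move=> {}mX; rewrite -(setTD X) measureD// setTI.
  transitivity (m1 setT - m1 (f1 @^-1` `]-oo, x]%classic))%E; first exact: tail.
  by rewrite mT mray; apply/esym/tail.
- move=> n; have mX : measurable (f1 @^-1` `](- n%:R), +oo[%classic).
    by rewrite -[X in measurable X]setTI; exact: (mf1 measurableT).
  by apply: le_lt_trans fin1; apply: (@le_measure _ _ _ m1); rewrite ?inE.
Qed.

(** From products of two rays to products of a ray and a Borel set, then to
    products of two Borel sets, applying [eq_law_of_rays] to one coordinate at a
    time; the common marginals provide the equality of total masses. *)
Lemma same_law_joint_cdf (mu nu : probability R R)
    (pi pi' : probability (R * R)%type R) :
  transport_plans mu nu pi -> transport_plans mu nu pi' ->
  (forall a b, joint_cdf pi a b = joint_cdf pi' a b) -> same_law pi pi'.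
Proof.
move=> [pi1 pi2] [pi1' pi2'] H.
have fstX A B : (A `*` B : set (R * R)) = fst @^-1` A `&` snd @^-1` B by [].
have sndX A B : (A `*` B : set (R * R)) = snd @^-1` B `&` fst @^-1` A by rewrite setIC.
have fin (p : probability (R * R)%type R) (D : set (R * R)) (mD : measurable D) :
    (mrestr p mD setT < +oo)%E.
  by rewrite /mrestr setTI; apply: le_lt_trans (ltry 1); exact: probability_le1.
have mf A := measurable_fst_preimage A.
have ms A := measurable_snd_preimage A.
have step1 a B : measurable B ->
    pi (`]-oo, a]%classic `*` B) = pi' (`]-oo, a]%classic `*` B).
  move=> mB; have mD := mf _ _ (measurable_itv `]-oo, a]).
  rewrite !sndX; apply: (eq_law_of_rays _ _ _ _ (mrestr pi mD) (mrestr pi' mD)) => //.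
    exact: fin.
    by rewrite /= /mrestr !setTI [LHS]pi1// [RHS]pi1'.
  move=> b; rewrite /= /mrestr -!sndX.
  have mab : measurable (`]-oo, a]%classic `*` `]-oo, b]%classic : set (R * R)).
    exact: measurableX.
  by rewrite -[LHS]fineK ?fin_num_measure// -[RHS]fineK ?fin_num_measure//; congr EFin; exact: H.
have step2 A B : measurable A -> measurable B -> pi (A `*` B) = pi' (A `*` B).
  move=> mA mB; have mD := ms _ _ mB.
  rewrite !fstX; apply: (eq_law_of_rays _ _ _ _ (mrestr pi mD) (mrestr pi' mD)) => //.
    exact: fin.
    by rewrite /= /mrestr !setTI [LHS]pi2// [RHS]pi2'.
  by move=> a; rewrite /= /mrestr -!fstX; exact: step1.
pose C : set (set (R * R)) :=
  [set D | exists A B, [/\ measurable A, measurable B & D = A `*` B]].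
move=> D mD; apply: (measure_unique C (fun=> setT)) => //.
- rewrite measurable_prod_measurableType; congr (<<s _ >>).
  apply/seteqP; split => [_ [A mA [B mB <-]]|_ [A [B [mA mB ->]]]].
    by exists A, B.
  by exists A => //; exists B.
- move=> _ _ [A [B [mA mB ->]]] [A' [B' [mA' mB' ->]]].
  exists (A `&` A'), (B `&` B'); split; [exact: measurableI|exact: measurableI|].
  by rewrite setXI.
- by move=> _; exists setT, setT; split => //; rewrite setXTT.
- by rewrite bigcup_const.
- by move=> _ [A [B [mA mB ->]]]; exact: step2.
- by move=> _; apply: le_lt_trans (ltry 1); exact: probability_le1.
Qed.

End laws.

(** * The diamond transport is a transport plan *)

Section diamond_plan.
Context {R : realType}.
Variables mu nu : probability R R.

Lemma diamond_transport_joint_cdf a b :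
  joint_cdf (diamond_transport mu nu) a b =
  diamond_copula (marginal_cdf mu a) (marginal_cdf nu b).
Proof.
have e := diamond_law_rect _ _ _ _ (measurable_quantile_sublevel mu a)
  (measurable_quantile_sublevel nu b) (marginal_cdf01 mu a)
  (marginal_cdf01 nu b) (quantile_sublevel mu a) (quantile_sublevel nu b).
by rewrite /joint_cdf [X in fine X]e.
Qed.

Lemma diamond_copula1r (u : R) : 0 <= u <= 1 -> diamond_copula u 1 = u.
Proof.
move=> /andP[u0 u1]; rewrite /diamond_copula (min_l u1) addrK (max_r u0).
by rewrite max_l// ge_min lexx.
Qed.

Lemma diamond_copula1l (u : R) : 0 <= u <= 1 -> diamond_copula 1 u = u.
Proof.
move=> /andP[u0 u1]; rewrite /diamond_copula (min_r u1) addrAC subrr add0r (max_r u0).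
by rewrite max_l// ge_min lexx.
Qed.

Lemma diamond_transport_plan : transport_plans mu nu (diamond_transport mu nu).
Proof.
have fin : (diamond_transport mu nu setT < +oo)%E.
  by apply: le_lt_trans (ltry 1); exact: probability_le1.
have one01 : 0 <= (1 : R) <= 1 by rewrite ler01 lexx.
have t1 (t : R) : 0 < t < 1 -> setT t <-> t <= 1.
  by move=> /andP[_ /ltW ?]; split.
split => A mA.
- apply: (eq_law_of_rays _ _ _ _ (diamond_transport mu nu) mu fst id) => //.
    exact: etrans (probability_setT _) (esym (probability_setT _)).
  move=> x; rewrite preimage_id; apply: etrans (esym (marginal_cdfE mu x)).
  have := diamond_law_rect _ _ _ _ (measurable_quantile_sublevel mu x)
    measurableT (marginal_cdf01 mu x) one01 (quantile_sublevel mu x) t1.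
  rewrite diamond_copula1r ?marginal_cdf01// => <-.
  by congr (diamond_law _); apply/seteqP; split => -[p q] //= [].
- apply: (eq_law_of_rays _ _ _ _ (diamond_transport mu nu) nu snd id) => //.
    exact: etrans (probability_setT _) (esym (probability_setT _)).
  move=> x; rewrite preimage_id; apply: etrans (esym (marginal_cdfE nu x)).
  have := diamond_law_rect _ _ _ _ measurableT
    (measurable_quantile_sublevel nu x) one01 (marginal_cdf01 nu x) t1 (quantile_sublevel nu x).
  rewrite diamond_copula1l ?marginal_cdf01// => <-.
  by congr (diamond_law _); apply/seteqP; split => -[p q] //= [].
Qed.

End diamond_plan.

(** * Regularity of cdfs and finiteness of the minimal energy *)

Section finite.
Context {R : realType}.
Let rT := measurableTypeR R.
Implicit Types (mu nu : probability R R) (pi : probability (R * R)%type R).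

Lemma measurable_marginal_cdf mu :
  measurable_fun setT (marginal_cdf mu : rT -> R).
Proof. by apply: nondecreasing_measurable => // a b; exact: le_marginal_cdf. Qed.

Lemma measurable_joint_cdf pi :
  measurable_fun setT (fun ab : rT * rT => joint_cdf pi ab.1 ab.2).
Proof.
pose S : set ((R * R) * (rT * rT)) :=
  [set w | (w.1.1 <= w.2.1) && (w.1.2 <= w.2.2)].
have mS : measurable S.
  rewrite -[X in measurable X]setTI.
  apply: measurable_and => //; apply: measurable_fun_ler;
    by apply: measurableT_comp => //; exact: measurableT_comp.
have := measurable_fun_ysection pi mS.
move=> /(measurableT_comp (@fine_measurable R setT measurableT)).
apply: eq_measurable_fun => -[a b] _ /=.
congr (fine (pi _)); apply/seteqP; split => p; rewrite /ysection/= inE /S/= !in_itv/=.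
  by move/andP.
by move=> ?; apply/andP.
Qed.

(** Both F (1 - F) <= F and F (1 - F) <= 1 - F; taking the first bound at
    negative thresholds and the second at the others bounds F (1 - F) at a by
    the probability that a separates x from 0, whose integral over a is the
    first absolute moment. *)
Lemma integral_cdf_mul_tail_lty mu : (\int[mu]_x `|x|%:E < +oo)%E ->
  (\int[leb]_a (marginal_cdf mu a * (1 - marginal_cdf mu a))%:E < +oo)%E.
Proof.
move=> mu1.
pose S : set (R * rT) := [set w | straddle w.1 0 w.2].
have mS : measurable S.
  by rewrite -[X in measurable X]setTI; apply: measurable_straddle.
apply: le_lt_trans mu1.
have := @indic_fubini_tonelli _ _ _ _ _ mu (@leb R) S mS.
rewrite indic_fubini_tonelli_FE// indic_fubini_tonelli_GE// => E.
rewrite [leRHS](_ : _ = \int[mu]_x (leb \o xsection S) x)%E; last first.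
  apply: eq_integral => x _; rewrite -[in LHS](subr0 x) -lebesgue_straddle/=.
  by congr (lebesgue_measure _); apply/seteqP; split => a; rewrite /xsection/= inE.
rewrite E; apply: ge0_le_integral => //.
- move=> a _; have /andP[? ?] := marginal_cdf01 mu a.
  by rewrite lee_fin mulr_ge0//; lra.
- apply/measurable_EFinP; apply: measurable_funM; first exact: measurable_marginal_cdf.
  by apply: measurable_funB => //; exact: measurable_marginal_cdf.
- exact: measurable_fun_ysection.
- move=> a _ /=; have /andP[F0 F1] := marginal_cdf01 mu a.
  have [a0|a0] := leP 0 a.
    have -> : ysection S a = ~` `]-oo, a]%classic.
      apply/seteqP; split => x; rewrite /ysection/= inE /S/straddle/= a0 in_itv/=;
      by case: (x <= a).
    rewrite probability_setC// marginal_cdfE -EFinB lee_fin; nra.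
  have -> : ysection S a = `]-oo, a]%classic.
    apply/seteqP; split => x; rewrite /ysection/= inE /S/straddle/= [0 <= a]leNgt a0 in_itv/=;
      by case: (x <= a).
  rewrite marginal_cdfE lee_fin; nra.
Qed.

(** Enlarging a lower left quadrant adds at most a vertical and a horizontal
    strip, whose masses are increments of the marginal cdfs. *)
Lemma joint_cdf_lipschitz mu nu pi a a' b b' : transport_plans mu nu pi ->
  a <= a' -> b <= b' ->
  joint_cdf pi a b <= joint_cdf pi a' b' <=
  joint_cdf pi a b + (marginal_cdf mu a' - marginal_cdf mu a) +
     (marginal_cdf nu b' - marginal_cdf nu b).
Proof.
move=> [pi1 pi2] aa bb.
have mX c : measurable (fst @^-1` `]-oo, c]%classic : set (R * R)).
  exact: measurable_fst_preimage.
have mY c : measurable (snd @^-1` `]-oo, c]%classic : set (R * R)).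
  exact: measurable_snd_preimage.
have mJ c d : measurable (`]-oo, c]%classic `*` `]-oo, d]%classic : set (R * R)).
  exact: measurableX.
have JE c d : pi (`]-oo, c]%classic `*` `]-oo, d]%classic) = (joint_cdf pi c d)%:E.
  by rewrite fineK// fin_num_measure.
have XE c : pi (fst @^-1` `]-oo, c]%classic) = (marginal_cdf mu c)%:E.
  by rewrite -marginal_cdfE; exact: pi1.
have YE c : pi (snd @^-1` `]-oo, c]%classic) = (marginal_cdf nu c)%:E.
  by rewrite -marginal_cdfE; exact: pi2.
apply/andP; split.
  rewrite -lee_fin -!JE le_measure ?inE//; apply: setSX; exact: subset_itvl.
have piD (X Y : set (R * R)) x y : measurable X -> measurable Y -> Y `<=` X ->
    pi X = x%:E -> pi Y = y%:E -> pi (X `\` Y) = (x - y)%:E.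
  move=> {}mX {}mY YX Xx Yy; have finX : (pi X < +oo)%E by rewrite Xx ltry.
  transitivity (pi X - pi Y)%E; last by rewrite Xx Yy EFinB.
  by rewrite measureD// (setIidr YX).
have XD : pi (fst @^-1` `]-oo, a']%classic `\` fst @^-1` `]-oo, a]%classic) =
    (marginal_cdf mu a' - marginal_cdf mu a)%:E.
  apply: piD => //.
  by apply: preimage_subset; exact: subset_itvl.
have YD : pi (snd @^-1` `]-oo, b']%classic `\` snd @^-1` `]-oo, b]%classic) =
    (marginal_cdf nu b' - marginal_cdf nu b)%:E.
  apply: piD => //.
  by apply: preimage_subset; exact: subset_itvl.
rewrite -lee_fin !EFinD -!EFinB -XD -YD -!JE.
have mXD := measurableD (mX a') (mX a).
have mYD := measurableD (mY b') (mY b).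
apply: le_trans (le_trans (measureU2 _ _ _) (leeD (measureU2 _ _ _) (lexx _))) => //.
- apply: le_measure; rewrite ?inE//.
    by apply: measurableU => //; exact: measurableU.
  move=> p [/= pa pb]; have [pa'|pa'] := leP p.1 a; last first.
    by left; right; split => //=; rewrite in_itv/= leNgt pa'.
  have [pb'|pb'] := leP p.2 b; last by right; split => //=; rewrite in_itv/= leNgt ?pa' ?pb'.
  by left; left; split; rewrite /= in_itv.
- exact: measurableU.
Qed.

End finite.

(** * Optimality and uniqueness *)

Section optimality.
Context {R : realType}.
Variables mu nu : probability R R.
Implicit Types pi : probability (R * R)%type R.
Let rT := measurableTypeR R.

Let F := marginal_cdf mu.
Let G := marginal_cdf nu.
Let dia := diamond_transport mu nu.

Definition crossing_density pi (ab : rT * rT) : R :=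
  crossing (marginal_cdf mu ab.1) (marginal_cdf nu ab.2) (joint_cdf pi ab.1 ab.2).

Lemma measurable_crossing_density pi : measurable_fun setT (crossing_density pi).
Proof.
have mF : measurable_fun setT (fun ab : rT * rT => F ab.1).
  by apply: measurableT_comp => //; exact: measurable_marginal_cdf.
have mG : measurable_fun setT (fun ab : rT * rT => G ab.2).
  by apply: measurableT_comp => //; exact: measurable_marginal_cdf.
have mH := measurable_joint_cdf pi.
rewrite /crossing_density /crossing; apply: measurable_funM => //.
apply: measurable_funD; apply: measurable_funM => //; last by apply: measurable_funB.
- apply: measurable_funD => //; apply: measurable_funB => //.
  exact: measurable_funB.
- exact: measurable_funB.
Qed.

Let mEFin pi : measurable_fun setT (fun ab => (crossing_density pi ab)%:E).
Proof. by apply/measurable_EFinP; exact: measurable_crossing_density. Qed.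

Lemma crossing_density_ge0 pi ab : transport_plans mu nu pi ->
  0 <= crossing_density pi ab.
Proof. by case/(joint_cdf_bounds _ _ _ ab.1 ab.2) => *; exact: crossing_ge0. Qed.

Lemma crossing_density_gap pi ab : transport_plans mu nu pi ->
  crossing_density dia ab +
    4 * (joint_cdf pi ab.1 ab.2 - joint_cdf dia ab.1 ab.2) ^+ 2
  <= crossing_density pi ab.
Proof.
case/(joint_cdf_bounds _ _ _ ab.1 ab.2) => *.
rewrite /crossing_density diamond_transport_joint_cdf.
exact: crossing_diamond_copula_min.
Qed.

Lemma rect_energy_density pi : transport_plans mu nu pi ->
  rect_energy pi = (\int[leb2]_ab (crossing_density pi ab)%:E)%E.
Proof. by move=> /rect_energyE ->. Qed.

Lemma rect_energy_diamond_min pi : transport_plans mu nu pi ->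
  (rect_energy dia <= rect_energy pi)%E.
Proof.
move=> pip; have dp := diamond_transport_plan mu nu.
rewrite !rect_energy_density//; apply: ge0_le_integral => //.
- by move=> ab _; rewrite lee_fin; exact: crossing_density_ge0.
- move=> ab _; rewrite lee_fin; apply: le_trans (crossing_density_gap _ _ pip).
  by rewrite lerDl mulr_ge0// sqr_ge0.
Qed.

(** The integrand of the diamond transport is at most that of the product plan,
    which is a product of a function of a and a function of b. *)
Lemma rect_energy_diamond_lty :
  (\int[mu]_x `|x|%:E < +oo)%E -> (\int[nu]_y `|y|%:E < +oo)%E ->
  (rect_energy dia < +oo)%E.
Proof.
move=> mu1 nu1; have dp := diamond_transport_plan mu nu.
pose vF (a : rT) : \bar R := (F a * (1 - F a))%:E.
pose vG (b : rT) : \bar R := (G b * (1 - G b))%:E.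
have v0 (m : probability R R) a : 0 <= marginal_cdf m a * (1 - marginal_cdf m a).
  by have /andP[? ?] := marginal_cdf01 m a; rewrite mulr_ge0//; lra.
have mv (m : probability R R) : measurable_fun setT (fun a : rT =>
    (marginal_cdf m a * (1 - marginal_cdf m a))%:E).
  apply/measurable_EFinP; apply: measurable_funM; first exact: measurable_marginal_cdf.
  by apply: measurable_funB => //; exact: measurable_marginal_cdf.
pose f (ab : rT * rT) : \bar R := (4%:E * vF ab.1 * vG ab.2)%E.
have f0 ab : (0 <= f ab)%E.
  by rewrite /f !mule_ge0// ?lee_fin//; exact: v0.
have mf : measurable_fun setT f.
  apply: emeasurable_funM; last by apply: measurableT_comp => //; exact: mv.
  by apply: emeasurable_funM => //; apply: measurableT_comp => //; exact: mv.
have : (\int[leb2]_ab f ab < +oo)%E.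
  rewrite [ltLHS](@fubini_tonelli1 _ _ _ _ _ leb leb f)//.
  rewrite /fubini_F /f/=.
  under eq_integral => a _.
    rewrite ge0_integralZl//; last 3 first.
    - exact: mv.
    - by move=> b _; rewrite lee_fin; exact: v0.
    - by rewrite mule_ge0// ?lee_fin//; exact: v0.
    over.
  have IG0 : (0 <= \int[leb]_b vG b)%E.
    by apply: integral_ge0 => b _; rewrite lee_fin; exact: v0.
  rewrite ge0_integralZr//; last 2 first.
  - by apply: emeasurable_funM => //; exact: mv.
  - by move=> a _; rewrite mule_ge0// ?lee_fin//; exact: v0.
  rewrite ge0_integralZl_EFin//; last 2 first.
  - by move=> a _; rewrite lee_fin; exact: v0.
  - exact: mv.
  apply: lte_mul_pinfty => //.
  - by rewrite mule_ge0// integral_ge0// => a _; rewrite lee_fin; exact: v0.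
  - rewrite ge0_fin_numE.
      by rewrite lte_mul_pinfty// integral_cdf_mul_tail_lty.
    by rewrite mule_ge0// integral_ge0// => a _; rewrite lee_fin; exact: v0.
  - exact: integral_cdf_mul_tail_lty.
apply: le_lt_trans; rewrite rect_energy_density//; apply: ge0_le_integral => //.
- by move=> ab _; rewrite lee_fin; exact: crossing_density_ge0.
- move=> ab _; rewrite /f /vF /vG -!EFinM lee_fin -crossing_indep.
  have /andP[F0 F1] := marginal_cdf01 mu ab.1.
  have /andP[G0 G1] := marginal_cdf01 nu ab.2.
  rewrite /crossing_density diamond_transport_joint_cdf.
  apply: le_trans (crossing_diamond_copula_min _ _ (F ab.1 * G ab.2) _ _ _ _); rewrite /F /G.
  + by rewrite lerDl mulr_ge0// sqr_ge0.
  + exact: mulr_ge0.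
  + nra.
  + by rewrite ler_piMr.
  + by rewrite ler_piMl.
Qed.

(** The excess of energy dominates the integral of 4 (H - H0)^2.  Finiteness of
    the minimal energy lets it be cancelled, so that this integral is 0. *)
Lemma joint_cdf_ae_eq pi : transport_plans mu nu pi ->
  (rect_energy pi <= rect_energy dia)%E -> (rect_energy dia < +oo)%E ->
  leb2.-negligible [set ab | joint_cdf pi ab.1 ab.2 <> joint_cdf dia ab.1 ab.2].
Proof.
move=> pip Epi Efin; have dp := diamond_transport_plan mu nu.
pose g (ab : rT * rT) : \bar R :=
  (4 * (joint_cdf pi ab.1 ab.2 - joint_cdf dia ab.1 ab.2) ^+ 2)%:E.
have g0 ab : (0 <= g ab)%E by rewrite lee_fin mulr_ge0// sqr_ge0.
have mg : measurable_fun setT g.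
  apply/measurable_EFinP; apply: measurable_funM => //.
  by apply: measurable_funX; apply: measurable_funB; exact: measurable_joint_cdf.
have Eg : (\int[leb2]_ab g ab = 0)%E.
  have : (rect_energy dia + \int[leb2]_ab g ab <= rect_energy dia)%E.
    apply: le_trans Epi; rewrite !rect_energy_density// -ge0_integralD//; last first.
      by move=> ab _; rewrite lee_fin; exact: crossing_density_ge0.
    apply: ge0_le_integral => //.
    - by move=> ab _; rewrite adde_ge0// lee_fin; exact: crossing_density_ge0.
    - exact: emeasurable_funD.
    - by move=> ab _; rewrite /g -EFinD lee_fin; exact: crossing_density_gap.
  have Ed0 : (0 <= rect_energy dia)%E.
    rewrite rect_energy_density//; apply: integral_ge0 => ab _.
    by rewrite lee_fin; exact: crossing_density_ge0.
  have fE : rect_energy dia \is a fin_num by rewrite ge0_fin_numE.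
  rewrite -{2}(adde0 (rect_energy dia)) leeD2lE// => h.
  by apply/eqP; rewrite eq_le h integral_ge0.
have : (\int[leb2]_ab `|g ab| = 0)%E.
  by rewrite -[RHS]Eg; apply: eq_integral => ab _; rewrite gee0_abs.
move=> /(ae_eq_integral_abs leb2 measurableT mg)[N [mN N0 sN]].
exists N; split => // ab; rewrite /= => abne; apply: sN => /= h; apply: abne.
have := h Logic.I; rewrite /g /cst => -[] /eqP.
by rewrite mulf_eq0 sqrf_eq0 subr_eq0 pnatr_eq0/= => /eqP.
Qed.

(** A nondegenerate rectangle has positive area. *)
Lemma negligible_avoid (P : set (rT * rT)) a b (e : R) : 0 < e ->
  leb2.-negligible P ->
  exists a' b', [/\ a <= a' <= a + e, b <= b' <= b + e & ~ P (a', b')].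
Proof.
move=> e0 [N [mN N0 PN]]; apply: contrapT => no.
have sub : `[a, (a + e)]%classic `*` `[b, (b + e)]%classic `<=` N.
  move=> [a' b'] [/=]; rewrite !in_itv/= => ha hb; apply: PN.
  by apply: contrapT => nP; apply: no; exists a', b'.
have mab : measurable (`[a, (a + e)]%classic `*` `[b, (b + e)]%classic : set (rT * rT)).
  exact: measurableX.
have abE : leb2 (`[a, (a + e)]%classic `*` `[b, (b + e)]%classic) = (e * e)%:E.
  rewrite [LHS]product_measure1E//= !lebesgue_measure_itv/= !lte_fin !ltrDl e0.
  by rewrite -!EFinB -EFinM; congr EFin; ring.
have : ((e * e)%:E <= 0 :> \bar R)%E.
  by rewrite -N0 -abE; apply: (@le_measure _ _ _ leb2); rewrite ?inE.
by rewrite lee_fin leNgt mulr_gt0.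
Qed.

(** Above and to the right of any point, and arbitrarily close to it, there is a
    point where the two joint cdfs agree.  By [joint_cdf_lipschitz] their values
    at the two points differ by increments of the marginal cdfs, which tend to 0
    by right continuity. *)
Lemma eq_joint_cdf_of_ae pi pi' : transport_plans mu nu pi -> transport_plans mu nu pi' ->
  leb2.-negligible [set ab | joint_cdf pi ab.1 ab.2 <> joint_cdf pi' ab.1 ab.2] ->
  forall a b, joint_cdf pi a b = joint_cdf pi' a b.
Proof.
move=> pip pip' neg a b; apply/eqP; rewrite -subr_eq0 -normr_le0.
apply/ler_addgt0Pr => e e0; rewrite add0r.
have e20 : 0 < e / 2 by rewrite divr_gt0.
have near_right (m : probability R R) c :
    exists2 d, 0 < d & marginal_cdf m (c + d) < marginal_cdf m c + e / 2.
  have h : \forall x \near c^'+, (marginal_cdf m x < marginal_cdf m c + e / 2) && (c < x).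
    near=> x; apply/andP; split; last by near: x; exact: nbhs_right_gt.
    near: x; apply: cvgr_lt (marginal_cdf_right_continuous m c) _ _.
    by rewrite ltrDl.
  have [x /andP[hx cx]] := @filter_ex _ _ (at_right_proper_filter c) _ h.
  by exists (x - c); [rewrite subr_gt0|rewrite addrC subrK].
have [d d0 hd] := near_right mu a; have [d' d'0 hd'] := near_right nu b.
have m0 : 0 < Num.min d d' by rewrite lt_min d0.
have [a' [b' [/andP[a1 a2] /andP[b1 b2] /contrapT/= eqab]]] :=
  negligible_avoid _ a b _ m0 neg.
have ha : marginal_cdf mu a' <= marginal_cdf mu (a + d).
  by apply: le_marginal_cdf; apply: (le_trans a2); rewrite lerD2l ge_min lexx.
have hb : marginal_cdf nu b' <= marginal_cdf nu (b + d').
  by apply: le_marginal_cdf; apply: (le_trans b2); rewrite lerD2l ge_min lexx orbT.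
have /andP[] := joint_cdf_lipschitz _ _ _ _ _ _ _ pip a1 b1.
have /andP[] := joint_cdf_lipschitz _ _ _ _ _ _ _ pip' a1 b1.
rewrite eqab ler_norml => *; apply/andP; split; lra.
Unshelve. all: by end_near. Qed.

End optimality.

Theorem theorem11 (R : realType) (mu nu : probability R R)
    (mu1 : (\int[mu]_x `|x|%:E < +oo)%E) (nu1 : (\int[nu]_y `|y|%:E < +oo)%E) :
  [/\ transport_plans mu nu (diamond_transport mu nu),
      (forall pi : probability (R * R)%type R, transport_plans mu nu pi ->
         (rect_energy (diamond_transport mu nu) <= rect_energy pi)%E) &
      (forall pi : probability (R * R)%type R, transport_plans mu nu pi ->
         (forall pi' : probability (R * R)%type R, transport_plans mu nu pi' ->
            (rect_energy pi <= rect_energy pi')%E) ->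
         same_law pi (diamond_transport mu nu))].
Proof.
have dp := diamond_transport_plan mu nu.
split => // [pi|pi pip pimin]; first exact: rect_energy_diamond_min.
apply: (same_law_joint_cdf _ _ _ _ pip dp); apply: (eq_joint_cdf_of_ae _ _ _ _ pip dp).
apply: joint_cdf_ae_eq => //; first exact: pimin.
exact: rect_energy_diamond_lty.
Qed.
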